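(* Let $\mathbb{I}$ be the ring of Hurwitz integers. For each $n \ge 3$ we have $Q_{A(\mathbb{I},n)} \ge 8n-20$.
   Context: $R=\mathbb{I}$ is the ring of Hurwitz integers: all quaternions $z=q+r\mathbf{i}+s\mathbf{j}+t\mathbf{k}$ with either $q,r,s,t\in\mathbb{Z}$ or $q,r,s,t\in\frac12+\mathbb{Z}$, with the usual quaternion multiplication. Its norm is $N(z)=q^2+r^2+s^2+t^2\in\mathbb{Z}$. For a positive integer $m$, $\mathrm{rad}(m)$ is the largest square-free positive divisor of $m$. For $a=(a_1,\dots,a_n)\in R^n$ with all $a_j\neq 0$, the quality is $$q(a)=\frac{\log(\max(N(a_1),\dots,N(a_n)))}{\log(\mathrm{rad}(N(a_1\cdots a_n)))}.$$ For an infinite (countable) set $S=\{a^{(1)},a^{(2)},\dots\}$ of such $n$-tuples (enumerated without repetition), $Q_S=\limsup_{k\to\infty}q(a^{(k)})$ (possibly $+\infty$). The finitely many tuples consisting only of units, for which the denominator is $0$, are disregarded in the limsup. $A(R,n)$ is the set of $a=(a_1,\dots,a_n)\in R^n$ with all $a_j\ne 0$ satisfying: (Z) $a_1+\dots+a_n=0$; (S1) there are no $b_1,\dots,b_n\in\{0,1\}$ and indices $i,j$ with $b_i=0$, $b_j=1$ and $\sum_{k=1}^n b_ka_k=0$; (G1) both the left g.c.d. and the right g.c.d. of $a_1,\dots,a_n$ equal $1$ (up to units). *)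

(* Defs.v *)
From HB Require Import structures.
From mathcomp Require Import all_boot all_order all_algebra.
From mathcomp Require Import ring.
From mathcomp Require Import boolp classical_sets functions cardinality.
From mathcomp Require Import reals ereal sequences exp.

Set Implicit Arguments.
Unset Strict Implicit.
Unset Printing Implicit Defensive.

Import Order.TTheory GRing.Theory Num.Theory.

Local Open Scope ring_scope.

(* Quat q r s t stands for q + r i + s j + t k, with rational coordinates. *)
Record quat := Quat { qre : rat; qim_i : rat; qim_j : rat; qim_k : rat }.

Definition quat_tuple (x : quat) : rat * rat * rat * rat :=
  (qre x, qim_i x, qim_j x, qim_k x).
Definition tuple_quat (u : rat * rat * rat * rat) : quat :=
  let: (q, r, s, t) := u in Quat q r s t.
Lemma quat_tupleK : cancel quat_tuple tuple_quat. Proof. by case. Qed.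

HB.instance Definition _ := Countable.copy quat (can_type quat_tupleK).

Definition addq (x y : quat) : quat :=
  Quat (qre x + qre y) (qim_i x + qim_i y)
       (qim_j x + qim_j y) (qim_k x + qim_k y).
Definition oppq (x : quat) : quat :=
  Quat (- qre x) (- qim_i x) (- qim_j x) (- qim_k x).
(* From i^2 = j^2 = k^2 = ijk = -1. *)
Definition mulq (x y : quat) : quat :=
  let: Quat a b c d := x in
  let: Quat a' b' c' d' := y in
  Quat (a * a' - b * b' - c * c' - d * d')
       (a * b' + b * a' + c * d' - d * c')
       (a * c' - b * d' + c * a' + d * b')
       (a * d' + b * c' - c * b' + d * a').

Lemma addqA : associative addq.
Proof. by move=> [? ? ? ?] [? ? ? ?] [? ? ? ?]; rewrite /addq /= !addrA. Qed.
Lemma addqC : commutative addq.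
Proof. by move=> [? ? ? ?] [? ? ? ?]; congr Quat => /=; rewrite addrC. Qed.
Lemma add0q : left_id (Quat 0 0 0 0) addq.
Proof. by move=> [? ? ? ?]; rewrite /addq /= !add0r. Qed.
Lemma addNq : left_inverse (Quat 0 0 0 0) oppq addq.
Proof. by move=> [? ? ? ?]; rewrite /addq /= !addNr. Qed.

HB.instance Definition _ :=
  GRing.isZmodule.Build quat addqA addqC add0q addNq.

Lemma mulqA : associative mulq.
Proof. by move=> [? ? ? ?] [? ? ? ?] [? ? ? ?]; congr Quat; ring. Qed.
Lemma mul1q : left_id (Quat 1 0 0 0) mulq.
Proof. by move=> [? ? ? ?]; congr Quat; ring. Qed.
Lemma mulq1 : right_id (Quat 1 0 0 0) mulq.
Proof. by move=> [? ? ? ?]; congr Quat; ring. Qed.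
Lemma mulqDl : left_distributive mulq +%R.
Proof. by move=> [? ? ? ?] [? ? ? ?] [? ? ? ?]; congr Quat => /=; ring. Qed.
Lemma mulqDr : right_distributive mulq +%R.
Proof. by move=> [? ? ? ?] [? ? ? ?] [? ? ? ?]; congr Quat => /=; ring. Qed.
Lemma oneq_neq0 : Quat 1 0 0 0 != 0 :> quat.
Proof. by apply/eqP; case. Qed.

HB.instance Definition _ := GRing.Zmodule_isNzRing.Build quat
  mulqA mul1q mulq1 mulqDl mulqDr oneq_neq0.

Definition is_hurwitz : {pred quat} := fun z =>
  [&& qre z \is a Num.int, qim_i z \is a Num.int,
      qim_j z \is a Num.int & qim_k z \is a Num.int] ||
  [&& qre z - 2^-1 \is a Num.int, qim_i z - 2^-1 \is a Num.int,
      qim_j z - 2^-1 \is a Num.int & qim_k z - 2^-1 \is a Num.int].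

Lemma is_hurwitzP (z : quat) :
  reflect (exists (e : bool) (a b c d : int), z =
             Quat (a%:~R + e%:R / 2) (b%:~R + e%:R / 2)
                  (c%:~R + e%:R / 2) (d%:~R + e%:R / 2))
          (z \in is_hurwitz).
Proof.
apply: (iffP orP) => [[]|[[] [a [b [c [d ->]]]]]].
- case: z => q r s t /= /and4P[/intrP[a ->] /intrP[b ->] /intrP[c ->]
    /intrP[d ->]].
  by exists false, a, b, c, d; rewrite mul0r !addr0.
- case: z => q r s t /= /and4P[/intrP[a Ha] /intrP[b Hb] /intrP[c Hc]
    /intrP[d Hd]].
  exists true, a, b, c, d.
  by rewrite !div1r -Ha -Hb -Hc -Hd !subrK.
- by right; rewrite /= !div1r !addrK !intr_int.
- by left; rewrite /= mul0r !addr0 !intr_int.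
Qed.

Lemma half_int (S : int) :
  exists (e : bool) (h : int), S%:~R / 2 = h%:~R + e%:R / 2 :> rat.
Proof.
exists ((S %% 2)%Z == 1), (S %/ 2)%Z.
have r0 : (0 <= S %% 2)%Z by exact: modz_ge0.
have r2 : ((S %% 2)%Z < 2) by exact: ltz_pmod.
have E : ((S %% 2)%Z == 1)%:Z = (S %% 2)%Z.
  by move: r0 r2; case: (S %% 2)%Z => [[|[|m]]|m].
by rewrite {1}(divz_eq S 2) -{1}E intrD intrM mulrDl mulfK.
Qed.

Lemma is_hurwitz_subring : subring_closed is_hurwitz.
Proof.
split.
- by apply/is_hurwitzP; exists false, 1, 0, 0, 0; rewrite mul0r !addr0.
- move=> x y /is_hurwitzP[e [a [b [c [d ->]]]]].
  move=> /is_hurwitzP[e' [a' [b' [c' [d' ->]]]]].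
  apply/is_hurwitzP; pose f : int := if ~~ e && e' then -1 else 0.
  exists (e (+) e'), (a - a' + f), (b - b' + f), (c - c' + f), (d - d' + f).
  by rewrite {}/f; case: e; case: e'; congr Quat => /=;
     rewrite !(intrD, mulrNz) /=; field.
move=> x y /is_hurwitzP[e [a [b [c [d ->]]]]].
move=> /is_hurwitzP[e' [a' [b' [c' [d' ->]]]]].
(* Modulo Z, all four coordinates of the product are half of the same T. *)
pose E : int := e; pose E' : int := e'.
pose T : int := E' * (a + b + c + d) + E * (a' + b' + c' + d') + E * E'.
have [g [h Th]] := half_int T.
have TE : T%:~R = e'%:R * (a%:~R + b%:~R + c%:~R + d%:~R) +
    e%:R * (a'%:~R + b'%:~R + c'%:~R + d'%:~R) + e%:R * e'%:R :> rat.
  by rewrite /T /E /E' !(intrD, intrM).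
apply/is_hurwitzP; exists g.
exists (a * a' - b * b' - c * c' - d * d'
        - E' * (b + c + d) - E * (b' + c' + d') - E * E' + h),
  (a * b' + b * a' + c * d' - d * c' - E' * d - E * c' + h),
  (a * c' - b * d' + c * a' + d * b' - E' * b - E * d' + h),
  (a * d' + b * c' - c * b' + d * a' - E' * c - E * b' + h).
have h2 : h%:~R = T%:~R / 2 - g%:R / 2 :> rat by rewrite Th addrK.
by congr Quat; rewrite !(intrD, intrM, mulrNz) h2 TE /E /E' -?pmulrn; field.
Qed.

HB.instance Definition _ :=
  GRing.isSubringClosed.Build quat is_hurwitz is_hurwitz_subring.

Record hurwitz := Hurwitz { hval : quat; hvalP : hval \in is_hurwitz }.
HB.instance Definition _ := [isSub for hval].
HB.instance Definition _ := [Countable of hurwitz by <:].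
HB.instance Definition _ := [SubChoice_isSubNzRing of hurwitz by <:].

Definition normq (z : quat) : rat :=
  qre z ^+ 2 + qim_i z ^+ 2 + qim_j z ^+ 2 + qim_k z ^+ 2.

(* The truncation loses nothing: see hnormE. *)
Definition hnorm (z : hurwitz) : nat := Num.truncn (normq (hval z)).

Lemma hnormE (z : hurwitz) : (hnorm z)%:R = normq (hval z).
Proof.
apply: truncnK; rewrite natrEint; apply/andP; split; last first.
  by rewrite /normq !addr_ge0 ?sqr_ge0.
have /is_hurwitzP[e [a [b [c [d ->]]]]] := hvalP z.
pose E : int := e.
rewrite /normq /=; apply/intrP.
exists (a ^+ 2 + b ^+ 2 + c ^+ 2 + d ^+ 2 + E * (a + b + c + d + 1)).
by rewrite /E !(intrD, intrM, rmorphXn); case: e {E} => /=; field.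
Qed.

Definition is_hunit (z : hurwitz) : Prop := exists w, z * w = 1 /\ w * z = 1.

Definition ldivides (d x : hurwitz) : Prop := exists y, x = d * y.
Definition rdivides (d x : hurwitz) : Prop := exists y, x = y * d.

Definition is_lgcd n (a : {ffun 'I_n -> hurwitz}) (d : hurwitz) : Prop :=
  (forall i, ldivides d (a i)) /\
  (forall c, (forall i, ldivides c (a i)) -> ldivides c d).
Definition is_rgcd n (a : {ffun 'I_n -> hurwitz}) (d : hurwitz) : Prop :=
  (forall i, rdivides d (a i)) /\
  (forall c, (forall i, rdivides c (a i)) -> rdivides c d).

Definition squarefree (d : nat) : bool :=
  all (fun k => (k ^ 2 %| d)%N ==> (k == 1%N)) (divisors d).
(* Meant for m > 0 (divisors 0 is empty). *)
Definition natrad (m : nat) : nat := \max_(d <- divisors m | squarefree d) d.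

Definition quality (R : realType) n (a : {ffun 'I_n -> hurwitz}) : R :=
  ln (\max_(i < n) hnorm (a i))%:R / ln (natrad (hnorm (\prod_(i < n) a i)))%:R.

Local Open Scope classical_set_scope.

(* Enumeration without repetition of S, disregarding the tuples of units. *)
Definition enumeration n (S : set {ffun 'I_n -> hurwitz})
    (e : nat -> {ffun 'I_n -> hurwitz}) : Prop :=
  set_bij [set: nat] (S `\` [set a | forall i, is_hunit (a i)]) e.

Definition limsup_quality (R : realType) n
    (e : nat -> {ffun 'I_n -> hurwitz}) : \bar R :=
  limn_esup (fun k => (quality R (e k))%:E).

Definition cond_Z n (a : {ffun 'I_n -> hurwitz}) : Prop :=
  \sum_(i < n) a i = 0.
Definition cond_S1 n (a : {ffun 'I_n -> hurwitz}) : Prop :=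
  ~ exists (b : {ffun 'I_n -> bool}) (i j : 'I_n),
      [/\ b i = false, b j = true & \sum_(k < n) (b k)%:R * a k = 0].
Definition cond_G1 n (a : {ffun 'I_n -> hurwitz}) : Prop :=
  is_lgcd a 1 /\ is_rgcd a 1.

Definition A_hurwitz n : set {ffun 'I_n -> hurwitz} :=
  [set a : {ffun 'I_n -> hurwitz} |
    [/\ forall i, a i != 0, cond_Z a, cond_S1 a & cond_G1 a]].
Arguments A_hurwitz n : clear implicits.

(* Main.v *)
Require Import Defs.
From mathcomp Require Import all_boot all_order all_algebra.
From mathcomp Require Import ring.
From mathcomp Require Import boolp classical_sets cardinality.
From mathcomp Require Import reals ereal sequences exp ereal_normedtype.

Import Order.TTheory GRing.Theory Num.Theory.

Local Open Scope ring_scope.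
Local Open Scope classical_set_scope.

(* With P = 3^(2^t), the number 3^(2^(t+1)) - 1 = (P - 1)(P + 1) is 8 times a
   product of sums of two squares, hence a sum of two squares x^2 + y^2. So
   (x + yi + j) and (-x - yi + j) have norm 3^(2^(t+1)), while their sum is the
   fixed element 2j. Completing by the fixed elements -(n-3) - 2j, 1, ..., 1
   gives tuples of unbounded height whose norms have bounded radical, so their
   quality is unbounded. *)

(** * The norm, and quaternions with integer coordinates *)

Lemma hnormM (x y : hurwitz) : hnorm (x * y) = (hnorm x * hnorm y)%N.
Proof.
apply/eqP; rewrite -(eqr_nat rat) natrM !hnormE.
case: x y => [[a b c d] ?] [[a' b' c' d'] ?]; rewrite /Defs.normq /=.
by apply/eqP; ring.
Qed.

Lemma hnorm1 : hnorm 1 = 1%N.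
Proof.
by apply/eqP; rewrite -(eqr_nat rat) hnormE /Defs.normq /= !expr0n !addr0.
Qed.

Lemma hnorm_unit (z : hurwitz) : is_hunit z -> hnorm z = 1%N.
Proof.
move=> [w [zw _]]; have := hnormM z w; rewrite zw hnorm1 => /esym/eqP.
by rewrite muln_eq1 => /andP[/eqP].
Qed.

Lemma lipschitz_subproof (a b c d : int) :
  Quat a%:~R b%:~R c%:~R d%:~R \in is_hurwitz.
Proof.
by apply/is_hurwitzP; exists false, a, b, c, d; rewrite mul0r !addr0.
Qed.

(** Integer coordinates turn sums, products and norms into integer identities that [ring]
    settles. *)
Definition lipschitz (a b c d : int) : hurwitz :=
  Hurwitz (lipschitz_subproof a b c d).

Lemma lipschitzD a b c d a' b' c' d' :
  lipschitz a b c d + lipschitz a' b' c' d' =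
  lipschitz (a + a') (b + b') (c + c') (d + d').
Proof. by apply: val_inj; rewrite /= !intrD. Qed.

Lemma lipschitzM a b c d a' b' c' d' :
  lipschitz a b c d * lipschitz a' b' c' d' =
  lipschitz (a * a' - b * b' - c * c' - d * d')
            (a * b' + b * a' + c * d' - d * c')
            (a * c' - b * d' + c * a' + d * b')
            (a * d' + b * c' - c * b' + d * a').
Proof.
by apply: val_inj; rewrite /= !(intrD, intrM, mulrNz).
Qed.

Lemma lipschitz_nat (n : nat) : lipschitz n 0 0 0 = n%:R.
Proof.
elim: n => [|n IHn]; first exact: val_inj.
have -> : n.+1%:R = n%:R + lipschitz 1 0 0 0.
  by rewrite -addn1 natrD; congr (_ + _); exact: val_inj.
by rewrite -IHn lipschitzD !addr0 -addn1 PoszD.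
Qed.

Lemma hnorm_lipschitz a b c d (m : nat) :
  a ^+ 2 + b ^+ 2 + c ^+ 2 + d ^+ 2 = m%:Z -> hnorm (lipschitz a b c d) = m.
Proof.
move=> E; apply/eqP; rewrite -(eqr_nat rat) hnormE /Defs.normq /=.
by rewrite pmulrn -E !intrD !rmorphXn.
Qed.

Lemma sum_two_squares_pow3 (t : nat) :
  exists x y : int, x ^+ 2 + y ^+ 2 + 1 = 3 ^+ (2 ^ t.+1).
Proof.
elim: t => [|t [x [y E]]]; first by exists 2, 2.
set P : int := 3 ^+ (2 ^ t.+1) in E *; pose Q : int := 3 ^+ (2 ^ t).
have PQ : P = Q ^+ 2 by rewrite -exprM -expnSr.
have -> : 3 ^+ (2 ^ t.+2) = P ^+ 2 :> int by rewrite -exprM -expnSr.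
(* These are the real and imaginary parts of (x + yi)(Q + i), whose norm is (P - 1)(Q^2 + 1). *)
exists (x * Q - y), (x + y * Q).
have -> : P ^+ 2 = (P - 1) * (Q ^+ 2 + 1) + 1 by rewrite PQ; ring.
by rewrite -E; ring.
Qed.

(** * Bounds on the radical *)

Lemma natrad_ge_prime (p m : nat) :
  (0 < m)%N -> prime p -> (p %| m)%N -> (p <= natrad m)%N.
Proof.
move=> m0 pp pm; apply: (@leq_bigmax_seq _ (divisors m) squarefree id).
  by rewrite -dvdn_divisors.
apply/allP => k; rewrite -dvdn_divisors ?prime_gt0 // => kp.
apply/implyP => k2p; case/primeP: (pp) => _ /(_ k kp)/orP[//|/eqP kE].
by move: k2p; rewrite kE => /dvdn_leq; rewrite prime_gt0 // leqNgt
  -{1}(expn1 p) ltn_exp2l ?prime_gt1 // => /(_ isT).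
Qed.

(** A squarefree divisor contains [p] at most once, and its part prime to [p] divides [m]. *)
Lemma natrad_expM (p k m : nat) :
  prime p -> (0 < m)%N -> (natrad (p ^ k * m) <= p * m)%N.
Proof.
move=> pp m0; have p0 := prime_gt0 pp; apply/bigmax_leqP_seq => d.
rewrite -dvdn_divisors ?muln_gt0 ?expn_gt0 ?p0 // => dm /allP sqf.
have d0 : (0 < d)%N by apply: dvdn_gt0 dm; rewrite muln_gt0 expn_gt0 p0.
apply: dvdn_leq; first by rewrite muln_gt0 p0.
have [d' cop dE] := pfactor_coprime pp d0.
have v1 : (logn p d <= 1)%N.
  rewrite leqNgt -pfactor_dvdn //; apply/negP => p2d.
  have /sqf/implyP/(_ p2d)/eqP p1 : p \in divisors d.
    by rewrite -dvdn_divisors //; apply: dvdn_trans p2d; rewrite dvdn_exp.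
  by rewrite p1 in pp.
move: (logn p d) v1 dE => v v1 dE; rewrite dE mulnC dvdn_mul //.
  by rewrite -{2}(expn1 p) dvdn_exp2l.
have : (d' %| p ^ k * m)%N by apply: dvdn_trans dm; rewrite dE dvdn_mulr.
by rewrite Gauss_dvdr // coprime_sym coprimeXl.
Qed.

(** * A criterion for coprimality *)

(** For odd k = 2h + 1, the element 1 = a a' - 2h is a combination of [a] and 2 with coefficients on
    the right, so a left divisor of both divides it. *)
Lemma ldivides1_odd_norm (d a a' : hurwitz) (k : nat) :
  odd k -> a * a' = k%:R -> ldivides d a -> ldivides d 2 -> ldivides d 1.
Proof.
move=> ok E [u au] [v v2]; exists (u * a' - v * k./2%:R).
rewrite mulrBr !mulrA -au -v2 E -{1}(odd_double_half k) ok natrD -mul2n natrM.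
by rewrite addrK.
Qed.

Lemma rdivides1_odd_norm (d a a' : hurwitz) (k : nat) :
  odd k -> a' * a = k%:R -> rdivides d a -> rdivides d 2 -> rdivides d 1.
Proof.
move=> ok E [u au] [v v2]; exists (a' * u - k./2%:R * v).
rewrite mulrBl -!mulrA -au -v2 E -{1}(odd_double_half k) ok natrD -muln2 natrM.
by rewrite addrK.
Qed.

(** * The tuples and their membership in [A_hurwitz] *)

(** Here [m] stands for n - 3, the number of trailing ones; entry 2 cancels these ones together with
    the 2j left by entries 0 and 1. *)
Definition hurwitz_entry (m : nat) (x y : int) (i : nat) : hurwitz :=
  match i with
  | 0 => lipschitz x y 1 0
  | 1 => lipschitz (- x) (- y) 1 0
  | 2 => lipschitz (- m%:Z) 0 (- 2) 0
  | _ => 1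
  end.

Definition hurwitz_tuple (m : nat) (x y : int) : {ffun 'I_m.+3 -> hurwitz} :=
  [ffun i : 'I_m.+3 => hurwitz_entry m x y i].

(** A general monoid law [op] covers both sums and noncommutative products; [F] sees the index so
    that it can carry the coefficients of (S1). *)
Lemma big_hurwitz_tuple (T : Type) (idx : T) (op : Monoid.law idx) (m : nat)
    (x y : int) (F : 'I_m.+3 -> hurwitz -> T)
    (i0 := ord0) (i1 := lift ord0 ord0) (i2 := lift ord0 (lift ord0 ord0)) :
  \big[op/idx]_(i < m.+3) F i (hurwitz_tuple m x y i) =
  op (F i0 (lipschitz x y 1 0)) (op (F i1 (lipschitz (- x) (- y) 1 0))
    (op (F i2 (lipschitz (- m%:Z) 0 (- 2) 0))
      (\big[op/idx]_(i < m) F (lift ord0 (lift ord0 (lift ord0 i))) 1))).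
Proof.
rewrite !big_ord_recl !ffunE /=; do 3 congr (op _ _).
by apply: eq_bigr => i _; rewrite ffunE.
Qed.

Lemma hurwitz_tuple_Z m x y : cond_Z (hurwitz_tuple m x y).
Proof.
rewrite /cond_Z (big_hurwitz_tuple _ _ _ _ _ _ (fun _ => id)).
rewrite sumr_const card_ord /=.
rewrite -lipschitz_nat !lipschitzD; apply: val_inj => /=.
by congr Quat; rewrite -[RHS]/(0%:~R); congr (_%:~R); ring.
Qed.

Lemma ord3P (m : nat) (P : 'I_m.+3 -> Prop) :
  P ord0 -> P (lift ord0 ord0) -> P (lift ord0 (lift ord0 ord0)) ->
  (forall i : 'I_m, P (lift ord0 (lift ord0 (lift ord0 i)))) -> forall i, P i.
Proof.
move=> P0 P1 P2 PS i; case: (unliftP ord0 i) => [j|] -> //.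
case: (unliftP ord0 j) => [k|] -> //.
by case: (unliftP ord0 k) => [l|] ->.
Qed.

(** The sum takes an extreme value, 0 or [#|I|], so the number of indices where [b i] differs from
    [c] is 0. *)
Lemma sum_bool_const (I : finType) (b : I -> bool) (c : bool) :
  (\sum_i b i = c * #|I|)%N -> forall i, b i = c.
Proof.
move=> E; have : (\sum_i (b i (+) c) == 0)%N.
  case: c E => E; last first.
    by rewrite mul0n in E; rewrite -[X in _ == X]E; apply/eqP/eq_bigr => i _;
      rewrite addbF.
  rewrite -(eqn_add2l (\sum_i b i)%N) -big_split /= addn0 E mul1n -sum1_card.
  by apply/eqP/eq_bigr => i _; case: (b i).
rewrite sum_nat_eq0 => /forallP H i; have := H i.
by case: (b i); case: (c).
Qed.

(* The j-coordinate forces the first three coefficients to be equal, and then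
   the real coordinate forces the others to follow. *)
Lemma hurwitz_tuple_S1 m x y : cond_S1 (hurwitz_tuple m x y).
Proof.
move=> [b [i [j [bi bj]]]].
rewrite (big_hurwitz_tuple _ _ _ _ _ _ (fun k z => (b k)%:R * z)) /=.
set b0 := b _; set b1 := b _; set b2 := b _.
pose bs k := b (lift ord0 (lift ord0 (lift ord0 k))).
have -> : \sum_(k < m) (bs k)%:R * 1 = (\sum_(k < m) bs k)%:R :> hurwitz.
  by rewrite natr_sum; apply: eq_bigr => k _; rewrite mulr1.
rewrite -!lipschitz_nat !lipschitzM !lipschitzD => /(congr1 hval)[re0 _ j0 _].
have bool3 (c0 c1 c2 : bool) : c0%:Z + c1 = 2 * c2%:Z -> c1 = c0 /\ c2 = c0.
  by case: c0; case: c1; case: c2.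
have [b10 b20] : b1 = b0 /\ b2 = b0.
  apply: bool3; apply/eqP; rewrite -subr_eq0 -(intr_eq0 rat) -[X in _ == X]j0.
  by apply/eqP; congr _%:~R; ring.
have bs0 : forall k, bs k = b0.
  apply: sum_bool_const; rewrite card_ord; apply/eqP.
  rewrite -eqz_nat PoszM -subr_eq0 -(intr_eq0 rat) -[X in _ == X]re0 b10 b20.
  by apply/eqP; congr _%:~R; ring.
have bE : forall k, b k = b0 by apply: ord3P.
by move: bi; rewrite bE -(bE j) bj.
Qed.

(** The first two entries suffice: a common divisor divides their sum 2j, hence 2, and it also
    divides an entry of odd norm [k]. *)
Lemma hurwitz_tuple_G1 m x y (k : nat) : odd k ->
  x ^+ 2 + y ^+ 2 + 1 = k%:Z -> cond_G1 (hurwitz_tuple m x y).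
Proof.
(* [a'] is the conjugate of [a]. *)
move=> ok E; pose a := lipschitz x y 1 0; pose a' := lipschitz x (- y) (- 1) 0.
have aa' : a * a' = k%:R.
  by rewrite lipschitzM -lipschitz_nat -E; congr lipschitz; ring.
have a'a : a' * a = k%:R.
  by rewrite lipschitzM -lipschitz_nat -E; congr lipschitz; ring.
(* [j] is minus the quaternion unit j, so multiplying a + b = 2j by it on either side gives 2. *)
pose b := lipschitz (- x) (- y) 1 0; pose j := lipschitz 0 0 (- 1) 0.
have abj : (a + b) * j = 2.
  by rewrite lipschitzD lipschitzM -[2]lipschitz_nat; congr lipschitz; ring.
have jab : j * (a + b) = 2.
  by rewrite lipschitzD lipschitzM -[2]lipschitz_nat; congr lipschitz; ring.
split; split=> [i|d dv].
- by exists (hurwitz_tuple m x y i); rewrite mul1r.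
- have := dv ord0; rewrite ffunE => /= da.
  apply: (ldivides1_odd_norm _ _ _ _ ok aa' da).
  have := dv (lift ord0 ord0); rewrite ffunE => /= -[v bv].
  have [u au] := da; exists ((u + v) * j).
  by rewrite mulrA mulrDr -au -bv.
- by exists (hurwitz_tuple m x y i); rewrite mulr1.
- have := dv ord0; rewrite ffunE => /= da.
  apply: (rdivides1_odd_norm _ _ _ _ ok a'a da).
  have := dv (lift ord0 ord0); rewrite ffunE => /= -[v bv].
  have [u au] := da; exists (j * (u + v)).
  by rewrite -mulrA mulrDl -au -bv.
Qed.

Lemma hurwitz_tuple_A m x y (k : nat) : odd k ->
  x ^+ 2 + y ^+ 2 + 1 = k%:Z -> A_hurwitz m.+3 (hurwitz_tuple m x y).
Proof.
move=> ok E; split; last exact: hurwitz_tuple_G1 E.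
- by apply: ord3P => [|||i]; rewrite ffunE ?oner_neq0 //; apply/eqP;
    move=> /(congr1 (fun z => qim_j (hval z)))/eqP; rewrite intr_eq0.
- exact: hurwitz_tuple_Z.
- exact: hurwitz_tuple_S1.
Qed.

Lemma hnorm_prod_hurwitz_tuple m x y (k : nat) :
  x ^+ 2 + y ^+ 2 + 1 = k%:Z ->
  hnorm (\prod_i hurwitz_tuple m x y i) = (k ^ 2 * (m ^ 2 + 4))%N.
Proof.
move=> E; rewrite (big_hurwitz_tuple _ _ _ _ _ _ (fun _ => id)) /=.
rewrite big1 // !hnormM hnorm1 muln1 mulnA.
congr (_ * _ * _)%N; apply: hnorm_lipschitz; rewrite -?E; ring.
Qed.

(** * Tuples of large height and bounded radical *)

Definition height n (a : {ffun 'I_n -> hurwitz}) : nat :=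
  \max_(i < n) hnorm (a i).

(** The upper bound on the radical depends on [m] alone while [t] is free; the lower bound keeps the
    denominator of the quality positive. *)
Lemma exists_large_quality m t :
  exists a : {ffun 'I_m.+3 -> hurwitz},
    [/\ A_hurwitz m.+3 a, ~ (forall i, is_hunit (a i)), (3 ^ t <= height _ a)%N,
        (2 < natrad (hnorm (\prod_i a i)%R))%N &
        (natrad (hnorm (\prod_i a i)%R) <= 3 * (m ^ 2 + 4))%N].
Proof.
have [x [y]] := sum_two_squares_pow3 t.
set k := (3 ^ (2 ^ t.+1))%N.
have -> : 3 ^+ (2 ^ t.+1) = k%:Z by rewrite /k -[RHS]natz natrX.
move=> E; have ok : odd k by rewrite oddX orbT.
pose a := hurwitz_tuple m x y; exists a.
have a0 : hnorm (a ord0) = k.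
  by rewrite ffunE; apply: hnorm_lipschitz; rewrite -E /=; ring.
have k3 : (3 <= k)%N by rewrite -{1}(expn1 3) leq_exp2l // expn_gt0.
have K : (0 < k ^ 2 * (m ^ 2 + 4))%N.
  by rewrite muln_gt0 expn_gt0 addn_gt0 orbT expn_gt0.
split; rewrite ?(hnorm_prod_hurwitz_tuple _ _ _ _ E).
- exact: hurwitz_tuple_A E.
- by move/(_ ord0)/hnorm_unit; rewrite a0 => k1; rewrite k1 in k3.
- apply: (@leq_trans k); last by rewrite -a0; apply: (leq_bigmax ord0).
  rewrite leq_exp2l // (leq_trans (ltnW (ltn_expl t (isT : 1 < 2)%N))) //.
  by rewrite leq_exp2l.
- apply: natrad_ge_prime => //.
  by rewrite dvdn_mulr // /k -expnM dvdn_exp // muln_gt0 expn_gt0.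
- by rewrite -expnM; apply: natrad_expM; rewrite // addn_gt0 orbT.
Qed.

(** The logarithm of the height is at least t ln 3, and that of the radical lies between 0,
    excluded, and ln K. *)
Lemma quality_ge (R : realType) n (a : {ffun 'I_n -> hurwitz}) (K t : nat) :
  (3 ^ t <= height _ a)%N -> (2 < natrad (hnorm (\prod_i a i)%R) <= K)%N ->
  t%:R * (ln 3 / ln K%:R) <= quality R a.
Proof.
move=> ta /andP[r2 rK]; rewrite /quality -/(height _ a).
set h := height _ a in ta *; set r := natrad _ in r2 rK *.
have r0 : (0 < r)%N by rewrite (ltn_trans _ r2).
have lnr : 0 < ln (r%:R : R) by rewrite ln_gt0 // ltr1n ltnW.
have lnrK : ln (r%:R : R) <= ln K%:R.
  by rewrite ler_ln ?posrE ?ltr0n ?ler_nat // ?(leq_trans r0 rK).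
have lnh : t%:R * ln 3 <= ln (h%:R : R).
  rewrite mulr_natl -lnXn // -natrX ler_ln ?posrE ?ltr0n ?ler_nat ?expn_gt0 //.
  by rewrite (leq_trans _ ta) // expn_gt0.
rewrite mulrA; apply: ler_pM => //.
- by rewrite mulr_ge0 // ln_ge0 // ler1n.
- by rewrite invr_ge0 (le_trans (ltW lnr)).
- by rewrite lef_pV2 ?posrE // (lt_le_trans lnr).
Qed.

(** * The limit superior along an enumeration *)

(** [limn_esup] is an infimum of suprema over neighbourhoods of infinity, and each of these contains
    some [k] with [x <= u k]. *)
Lemma limn_esup_ge (R : realType) (u : nat -> \bar R) (x : \bar R) :
  (forall N, exists2 k, (N <= k)%N & (x <= u k)%E) -> (x <= limn_esup u)%E.
Proof.
move=> H; apply: le_ereal_inf_tmp => _ [V [N _ NV] <-].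
have [k Nk xk] := H N; apply: le_trans xk _.
by apply: ereal_sup_ubound; exists k => //; apply: NV.
Qed.

Theorem theorem4p9 (R : realType) (n : nat) (hn : (3 <= n)%N) :
  infinite_set (A_hurwitz n) /\
  (forall e : nat -> {ffun 'I_n -> hurwitz}, enumeration (A_hurwitz n) e ->
     ((8 * n%:R - 20)%:E <= limsup_quality R e)%E).
Proof.
case: n hn => [|[|[|m]]] // _; split.
  (* If the set were a finite list with largest height T, a tuple of height at least 3^T > T would
     lie outside it. *)
  move=> /finite_seqP[s sE].
  have [a [Aa _ la _ _]] := exists_large_quality m (\max_(b <- s) height _ b).
  have : a \in s by have := Aa; rewrite sE.
  move=> as_; have := @leq_bigmax_seq _ _ predT (fun b => height _ b) _ as_ isT.
  by rewrite leqNgt (leq_trans _ la) // ltn_expl.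
move=> e [_ _ surj]; apply: limn_esup_ge => N.
set C : R := 8 * _ - 20; set K := (3 * (m ^ 2 + 4))%N.
have c0 : 0 < ln 3 / ln K%:R :> R.
  by rewrite divr_gt0 // ln_gt0 // ltr1n // /K mulnDr addnC.
(* The first argument makes t (ln 3 / ln K) at least [C]; the second makes the new tuple higher than
   each of the first [N] terms of [e]. *)
pose t := maxn (Num.bound `|C / (ln 3 / ln K%:R)|)
  (\max_(k < N) height _ (e k)).
have [a [Aa ua la r2 rK]] := exists_large_quality m t.
have [k _ ka] := surj a (conj Aa ua).
exists k.
  (* An index below [N] would give a height of at most t < 3^t. *)
  rewrite leqNgt; apply/negP => kN.
  have := leq_bigmax (Ordinal kN) (F := fun k : 'I_N => height _ (e k)).
  rewrite /= ka leqNgt (leq_trans _ la) // /t.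
  exact: leq_ltn_trans (leq_maxr _ _) (ltn_expl _ _).
rewrite lee_fin ka; apply: le_trans (quality_ge R _ _ K t la _).
  2: by rewrite r2.
rewrite -ler_pdivrMr // (le_trans (ler_norm _)) //.
rewrite (le_trans (ltW (archi_boundP (normr_ge0 _)))) // ler_nat.
exact: leq_maxl.
Qed.
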